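(* Let $k\ge 1$ and let $\underline{T}=(T_1,\dots,T_k)$ be a $q$-commuting tuple of non-zero contractions acting on $\mathbb{C}^2$. Then either $\underline{T}$ is a commuting tuple, or, up to a permutation of the indices $1,\dots,k$, there is a basis of $\mathbb{C}^2$ (not necessarily orthonormal) with respect to which the matrices of $T_1,\dots,T_k$ have one of the following three forms. Type-$I$: $T_1=\begin{pmatrix} a & 0 \\ 0 & ra \end{pmatrix}$ with $a\neq0$, $r\in\mathbb{T}\setminus\{\pm1\}$; $q_{1j}\in\{1,r\}$ for $2\le j\le k$; and for $2\le j\le k$, $T_j=\begin{pmatrix} c_j & 0 \\ 0 & f_j \end{pmatrix}$ with $|c_j|=|f_j|\ne0$ if $j\in\eta_1$, and $T_j=\begin{pmatrix} 0 & 0 \\ {e_j} & 0 \end{pmatrix}$ with $e_j\neq0$ if $j\in\eta_r$. Type-$II$: $T_1=\begin{pmatrix} a & 0 \\ 0 & ra \end{pmatrix}$ with $a\neq0$, $r\in\mathbb{T}\setminus\{\pm1\}$; $q_{1j}\in\{1,\overline r\}$ for $2\le j\le k$; and for $2\le j\le k$, $T_j=\begin{pmatrix} c_j & 0 \\ 0 & f_j \end{pmatrix}$ with $|c_j|=|f_j|\ne0$ if $j\in\eta_1$, and $T_j=\begin{pmatrix} 0 & d_j \\ 0 & 0 \end{pmatrix}$ with $d_j\neq0$ if $j\in\eta_{\overline r}$. Type-$III$: $T_1=\begin{pmatrix} a & 0 \\ 0 & -a \end{pmatrix}$ with $a\neq0$; $q_{1j}\in\{1,-1\}$ for $2\le j\le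 k$; and for $2\le j\le k$, $T_j=\begin{pmatrix} c_j & 0 \\ 0 & \pm c_j \end{pmatrix}$ with $c_j\ne0$ if $j\in\eta_1$, and $T_j=\begin{pmatrix} 0 & d_j \\ {e_j} & 0 \end{pmatrix}$ with $d_j\neq0$ or $e_j\ne0$ if $j\in\eta_{-1}$.
   Context: A tuple $\underline{T}=(T_1,\dots,T_k)$ of bounded operators on a complex Hilbert space is $q$-commuting if $q=\{q_{ij}\in\mathbb{C}: |q_{ij}|=1,\ q_{ij}=q_{ji}^{-1},\ 1\le i<j\le k\}$ is a family of unimodular scalars with $T_iT_j=q_{ij}T_jT_i$ for $1\le i<j\le k$. A contraction is an operator of norm at most $1$. $\mathbb{T}$ is the unit circle in $\mathbb{C}$. For $\alpha\in\mathbb{C}$, $\eta_\alpha=\{i: 1\le i\le k,\ T_1T_i=\alpha T_iT_1\}$. ''Up to a permutation of indices'' means that the operators $T_1,\dots,T_k$ (and correspondingly the scalars $q_{ij}$, with $q_{ji}=q_{ij}^{-1}$) may be relabelled by a permutation of $\{1,\dots,k\}$ before the conclusion is read; $T_1$, $q_{1j}$ and $\eta_\alpha$ then refer to the relabelled tuple. *)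

(* Defs.v *)
From HB Require Import structures.
From mathcomp Require Import all_boot all_order all_algebra all_fingroup.
From mathcomp Require Import classical_sets reals complex.
Set Implicit Arguments.
Unset Strict Implicit.
Unset Printing Implicit Defensive.
Import Order.TTheory GRing.Theory Num.Theory.
Local Open Scope ring_scope.

(* The Hilbert space C^2 is 'cV[R[i]]_2 with its Euclidean norm; since it is
   finite dimensional, its bounded operators are all its endomorphisms. *)
Definition norm2 (R : realType) (v : 'cV[R[i]]_2) : R :=
  Num.sqrt (\sum_(i < 2) Normc.normc (v i ord0) ^+ 2).

(* The set is nonempty and, in finite dimension, bounded, so that this supremum
   is never the default value of [sup]. *)
Definition op_norm (R : realType) (T : 'End('cV[R[i]]_2)) : R :=
  sup [set norm2 (T v) | v in [set v | norm2 v <= 1]]%classic.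

Definition contraction (R : realType) (T : 'End('cV[R[i]]_2)) : Prop :=
  op_norm T <= 1.

(* Nothing is required of the unused diagonal scalars [q i i]. *)
Definition q_commuting (R : realType) (k : nat) (q : 'I_k -> 'I_k -> R[i])
    (T : 'I_k -> 'End('cV[R[i]]_2)) : Prop :=
  forall i j : 'I_k, (i < j)%N ->
    [/\ `|q i j| = 1, q i j = (q j i)^-1
      & (T i \o T j)%VF = q i j *: (T j \o T i)%VF].

Definition commuting (R : realType) (k : nat)
    (T : 'I_k -> 'End('cV[R[i]]_2)) : Prop :=
  forall i j : 'I_k, (T i \o T j)%VF = (T j \o T i)%VF.

(* Column j holds the coordinates in b of the image of the j-th vector of b. *)
Definition mx_in_basis (R : realType) (b : 2.-tuple 'cV[R[i]]_2)
    (T : 'End('cV[R[i]]_2)) : 'M[R[i]]_2 :=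
  \matrix_(i < 2, j < 2) coord b i (T (tnth b j)).

Definition mx2 (R : realType) (a b c d : R[i]) : 'M[R[i]]_2 :=
  \matrix_(i < 2, j < 2) nth 0 (nth [::] [:: [:: a; b]; [:: c; d]] i) j.

(* From here on tuples have length n.+1, and ord0 plays the role of index 1. *)
Definition eta_set (R : realType) (n : nat)
    (T : 'I_n.+1 -> 'End('cV[R[i]]_2)) (alpha : R[i]) : {set 'I_n.+1} :=
  [set i | (T ord0 \o T i)%VF == alpha *: (T i \o T ord0)%VF].

Definition type_I (R : realType) (n : nat) (q : 'I_n.+1 -> 'I_n.+1 -> R[i])
    (T : 'I_n.+1 -> 'End('cV[R[i]]_2)) (b : 2.-tuple 'cV[R[i]]_2) : Prop :=
  exists a r : R[i],
    [/\ a != 0, [/\ `|r| = 1, r != 1 & r != -1],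
        mx_in_basis b (T ord0) = mx2 a 0 0 (r * a)
      & forall j : 'I_n.+1, j != ord0 ->
          [/\ q ord0 j = 1 \/ q ord0 j = r,
              j \in eta_set T 1 ->
                exists c f : R[i], [/\ `|c| = `|f|, `|f| != 0
                  & mx_in_basis b (T j) = mx2 c 0 0 f]
            & j \in eta_set T r ->
                exists e : R[i], e != 0 /\ mx_in_basis b (T j) = mx2 0 0 e 0]].

Definition type_II (R : realType) (n : nat) (q : 'I_n.+1 -> 'I_n.+1 -> R[i])
    (T : 'I_n.+1 -> 'End('cV[R[i]]_2)) (b : 2.-tuple 'cV[R[i]]_2) : Prop :=
  exists a r : R[i],
    [/\ a != 0, [/\ `|r| = 1, r != 1 & r != -1],
        mx_in_basis b (T ord0) = mx2 a 0 0 (r * a)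
      & forall j : 'I_n.+1, j != ord0 ->
          [/\ q ord0 j = 1 \/ q ord0 j = r^*,
              j \in eta_set T 1 ->
                exists c f : R[i], [/\ `|c| = `|f|, `|f| != 0
                  & mx_in_basis b (T j) = mx2 c 0 0 f]
            & j \in eta_set T r^* ->
                exists d : R[i], d != 0 /\ mx_in_basis b (T j) = mx2 0 d 0 0]].

Definition type_III (R : realType) (n : nat) (q : 'I_n.+1 -> 'I_n.+1 -> R[i])
    (T : 'I_n.+1 -> 'End('cV[R[i]]_2)) (b : 2.-tuple 'cV[R[i]]_2) : Prop :=
  exists a : R[i],
    [/\ a != 0, mx_in_basis b (T ord0) = mx2 a 0 0 (- a)
      & forall j : 'I_n.+1, j != ord0 ->
          [/\ q ord0 j = 1 \/ q ord0 j = -1,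
              j \in eta_set T 1 ->
                exists c : R[i], c != 0 /\
                  (mx_in_basis b (T j) = mx2 c 0 0 c \/
                   mx_in_basis b (T j) = mx2 c 0 0 (- c))
            & j \in eta_set T (-1) ->
                exists d e : R[i], (d != 0 \/ e != 0) /\
                  mx_in_basis b (T j) = mx2 0 d e 0]].

(* Main.v *)
Require Import Defs.
From HB Require Import structures.
From mathcomp Require Import all_boot all_order all_algebra all_fingroup.
From mathcomp Require Import classical_sets reals complex.
From mathcomp Require Import ring.
Set Implicit Arguments.
Unset Strict Implicit.
Unset Printing Implicit Defensive.
Import Order.TTheory GRing.Theory Num.Theory.
Local Open Scope ring_scope.

(* If [A B = p B A <> 0] with [p <> 1], then one of the two operators, say [A],
   has an eigenvector [v] with a nonzero eigenvalue and [B v <> 0]. In the basis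
   [v, B v] the matrix of [A] is diagonal with ratio [p], and comparing entries
   shows that whatever commutes with [A] up to a scalar is diagonal or
   antidiagonal. If [p <> -1], then [B] is a multiple of [E21], which forces
   Type I. If [p = -1], either all diagonal members have equal or opposite
   entries (Type III), or some diagonal member [D] does not; then [D B = p' B D]
   with [p' <> 1, -1], and relabelling [D] as the first operator gives Type I.
   Type II is never needed: exchanging the basis vectors turns it into Type I. *)

Lemma fixed_mul_eq0 (F : fieldType) (p x : F) : p != 1 -> x = p * x -> x = 0.
Proof.
move=> p1 xE; apply/eqP; have /eqP : (1 - p) * x = 0.
  by rewrite mulrBl mul1r -xE subrr.
by rewrite mulf_eq0 subr_eq0 eq_sym (negPf p1).
Qed.

(** * Eigenvectors, bases and matrices for operators on the plane *)

Section PlaneOperators.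
Variable R : realType.
Implicit Types (A B : 'End('cV[R[i]]_2)) (b : 2.-tuple 'cV[R[i]]_2).
Implicit Types (v w : 'cV[R[i]]_2) (a r p lam mu : R[i]).

Lemma mx2E (M : 'M[R[i]]_2) : M = mx2 (M 0 0) (M 0 1) (M 1 0) (M 1 1).
Proof.
apply/matrixP => i j; rewrite mxE.
by case: i j => [[|[|//]] /= ?] [[|[|//]] /= ?]; congr (M _ _); apply: val_inj.
Qed.

Lemma end_eigenvector A : exists lam v, v != 0 /\ A v = lam *: v.
Proof.
(* Matrix eigenvectors are row vectors, so [A] is conjugated by transposition; an eigenvalue exists
   because [R[i]] is algebraically closed. *)
pose M := lin1_mx (trmx \o A \o trmx : 'rV[R[i]]_2 -> 'rV[R[i]]_2).
have [lam /eigenvalueP[u uM u0]] := @eigenvalue_closed R[i] 2 M isT.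
exists lam, u^T; split.
  by apply: contra_neq u0 => u0; rewrite -[u]trmxK u0 trmx0.
by move: uM; rewrite mul_rV_lin1 /= => /(congr1 trmx); rewrite trmxK linearZ.
Qed.

Lemma basis_pair v w : v != 0 -> w \notin <[v]>%VS ->
  basis_of fullv [tuple v; w].
Proof.
move=> v0 wv; rewrite basisEfree subvf dimvf /=.
(* [free_cons] tests the head against the span of the tail, so [w] is moved to the front. *)
rewrite (perm_free (permEl (perm_catC [:: v] [:: w]))) free_cons seq1_free v0.
by rewrite span_seq1 wv.
Qed.

Lemma basis_extend v : v != 0 -> exists w, basis_of fullv [tuple v; w].
Proof.
move=> v0; have /subvPn[w _ wv] : ~~ (fullv <= <[v]>)%VS.
  by apply/negP => /dimvS; rewrite dimvf dim_vline v0.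
by exists w; apply: basis_pair.
Qed.

Lemma eigen_basis A v w lam mu : v != 0 -> w != 0 ->
  A v = lam *: v -> A w = mu *: w -> lam != mu -> basis_of fullv [tuple v; w].
Proof.
move=> v0 w0 Av Aw lm; apply: basis_pair => //.
apply/negP => /vlineP[k wE]; move/negP: w0; apply.
move: Aw; rewrite wE linearZ /= Av !scalerA => /eqP.
rewrite -subr_eq0 -scalerBl scaler_eq0 (negPf v0) orbF (mulrC mu) -mulrBr.
by rewrite mulf_eq0 subr_eq0 (negPf lm) orbF => /eqP->; rewrite scale0r.
Qed.

Lemma mx_in_basisP A b (j : 'I_2) : basis_of fullv b ->
  A (tnth b j) =
    mx_in_basis b A 0 j *: tnth b 0 + mx_in_basis b A 1 j *: tnth b 1.
Proof.
move=> bP; rewrite [LHS](coord_basis bP (memvf _)) big_ord_recl big_ord1.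
have -> : lift ord0 ord0 = 1 :> 'I_2 by exact: val_inj.
by rewrite !mxE !(tnth_nth 0).
Qed.

Lemma coord_pair b (x y : R[i]) : basis_of fullv b ->
  (coord b 0 (x *: tnth b 0 + y *: tnth b 1) = x) *
  (coord b 1 (x *: tnth b 0 + y *: tnth b 1) = y).
Proof.
move=> /basis_free bF; rewrite !linearD !linearZ /= !(tnth_nth 0) !coord_free //.
by split; rewrite /= !(mulr0, mulr1, addr0, add0r).
Qed.

Lemma mx_in_basis_eq A b (j : 'I_2) (x y : R[i]) : basis_of fullv b ->
  A (tnth b j) = x *: tnth b 0 + y *: tnth b 1 ->
  mx_in_basis b A 0 j = x /\ mx_in_basis b A 1 j = y.
Proof. by move=> bP Ab; rewrite !mxE Ab !coord_pair. Qed.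

Lemma mx_in_basis_comp A B b (i j : 'I_2) : basis_of fullv b ->
  mx_in_basis b (A \o B)%VF i j =
    mx_in_basis b A i 0 * mx_in_basis b B 0 j +
    mx_in_basis b A i 1 * mx_in_basis b B 1 j.
Proof.
move=> bP; rewrite [LHS]mxE comp_lfunE (mx_in_basisP B) // linearD !linearZ /=.
by rewrite linearD !linearZ !mxE /= mulrC; congr (_ + _); rewrite mulrC.
Qed.

Lemma mx_in_basis_scale A b x (i j : 'I_2) :
  mx_in_basis b (x *: A) i j = x * mx_in_basis b A i j.
Proof. by rewrite !mxE scale_lfunE linearZ. Qed.

Lemma mx_in_basis_eq0 A b : basis_of fullv b -> mx_in_basis b A = 0 -> A = 0.
Proof.
move=> bP A0; apply/lfunP => v; rewrite zero_lfunE.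
rewrite (coord_basis bP (memvf v)) linear_sum big1 // => i _.
rewrite linearZ /= -tnth_nth mx_in_basisP // A0 !mxE !scale0r addr0.
exact: scaler0.
Qed.

Lemma mx2_0 : mx2 0 0 0 0 = 0 :> 'M[R[i]]_2.
Proof. by rewrite [RHS]mx2E !mxE. Qed.

(** * Scalar commutation relations read on matrix entries *)

Lemma mx_in_basis_qcomm A B b p (i j : 'I_2) : basis_of fullv b ->
  (A \o B)%VF = p *: (B \o A)%VF ->
  let M := mx_in_basis b A in let N := mx_in_basis b B in
  M i 0 * N 0 j + M i 1 * N 1 j = p * (N i 0 * M 0 j + N i 1 * M 1 j).
Proof.
move=> bP AB M N.
by rewrite -!mx_in_basis_comp // AB mx_in_basis_scale.
Qed.

(** A diagonal [A] only rescales rows and columns of [B], so the relation decouples into one scalar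
    equation per entry. An entry whose coefficients differ must vanish, by [fixed_mul_eq0]; a
    nonzero entry determines [p]. *)
Lemma diag_qcomm A B b a r p : basis_of fullv b -> a != 0 -> r != 0 ->
  mx_in_basis b A = mx2 a 0 0 (r * a) -> (A \o B)%VF = p *: (B \o A)%VF ->
  let N := mx_in_basis b B in
  [/\ N 0 0 = p * N 0 0, N 0 1 = p * r * N 0 1,
      r * N 1 0 = p * N 1 0 & N 1 1 = p * N 1 1].
Proof.
move=> bP a0 r0 MA AB N; have E i j := mx_in_basis_qcomm i j bP AB.
have ra0 : r * a != 0 by rewrite mulf_neq0.
move: (E 0 0) (E 0 1) (E 1 0) (E 1 1); rewrite /= MA -/N !mxE /=.
rewrite !(mul0r, mulr0, add0r, addr0); move: N {E} => N E00 E01 E10 E11.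
split.
- by apply: (mulfI a0); rewrite E00; ring.
- by apply: (mulfI a0); rewrite E01; ring.
- by apply: (mulfI a0); rewrite mulrCA mulrA E10; ring.
- by apply: (mulfI ra0); rewrite E11; ring.
Qed.

Lemma commute_diag A B b a r : basis_of fullv b -> a != 0 -> r != 0 -> r != 1 ->
  mx_in_basis b A = mx2 a 0 0 (r * a) ->
  (A \o B)%VF = 1 *: (B \o A)%VF ->
  mx_in_basis b B 0 1 = 0 /\ mx_in_basis b B 1 0 = 0.
Proof.
move=> bP a0 r0 r1 MA AB; have [_ y0 z0 _] := diag_qcomm bP a0 r0 MA AB.
rewrite mul1r in y0; split; first exact: fixed_mul_eq0 r1 y0.
by apply: fixed_mul_eq0 r1 _; rewrite z0 mul1r.
Qed.

(** Triangularize [A] on an eigenvector [v]. If [B v] leaves the line of [v], then [v] serves, since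
    a zero eigenvalue would force [A = 0]. Otherwise both matrices are upper triangular and the
    diagonal of [B A] vanishes. Its corner entry is then nonzero, which gives one of the two
    operators distinct diagonal entries in ratio [p] or its inverse, and the eigenvector for the
    second of them serves. *)
Lemma qcomm_eigenvector A B p : p != 0 -> p != 1 ->
  (A \o B)%VF = p *: (B \o A)%VF -> (B \o A)%VF != 0 ->
  exists v lam, lam != 0 /\
    ((A v = lam *: v /\ B v != 0) \/ (B v = lam *: v /\ A v != 0)).
Proof.
move=> p0 p1 AB BA0; have [lam [v [v0 Av]]] := end_eigenvector A.
have [w bP] := basis_extend v0; set b := [tuple v; w] in bP.
have bv : tnth b 0 = v by []. have bw : tnth b 1 = w by [].
have [] := @mx_in_basis_eq A b 0 lam 0 bP; first by rewrite scale0r addr0.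
have := @mx_in_basisP A b 1 bP; have := @mx_in_basisP B b 0 bP.
have := @mx_in_basisP B b 1 bP; rewrite bv bw.
have BAE i j := mx_in_basis_comp B A i j bP.
have E i j := mx_in_basis_qcomm i j bP AB.
move: (E 0 0) (E 0 1) (E 1 0) (E 1 1) (BAE 0 0) (BAE 0 1) (BAE 1 0) (BAE 1 1).
rewrite /=.
set M := mx_in_basis b A; set N := mx_in_basis b B.
set P := mx_in_basis b _.
move: (M 0 0) (M 0 1) (M 1 0) (M 1 1) => l m z' mu.
move: (N 0 0) (N 0 1) (N 1 0) (N 1 1) => x y z t.
move=> E00 E01 E10 E11 P00 P01 P10 P11 Bw Bv Aw lE z'E; subst l z'.
have {}BA0 : ~ [/\ P 0 0 = 0, P 0 1 = 0, P 1 0 = 0 & P 1 1 = 0].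
  move=> [H1 H2 H3 H4]; move/eqP: BA0; apply; apply: (mx_in_basis_eq0 bP).
  by rewrite [LHS]mx2E -/P H1 H2 H3 H4 mx2_0.
rewrite !(mul0r, mulr0, add0r, addr0) in E00 E01 E10 E11 P00 P10.
have comb0 (c d : R[i]) : (c != 0) || (d != 0) -> c *: v + d *: w != 0.
  move=> cd; apply/eqP => H; have := coord_pair c d bP; rewrite bv bw H.
  by rewrite !linear0 => -[c0 d0]; move: cd; rewrite -c0 -d0 eqxx.
have [z0|z0] := eqVneq z 0; last first.
  have [lam0|lam0] := eqVneq lam 0; last first.
    by exists v, lam; split=> //; left; split=> //; rewrite Bv comb0 ?z0 ?orbT.
  subst lam; case: BA0.
  have mu0 : mu = 0 by apply: (mulIf z0); rewrite E10 mul0r !mulr0.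
  have m0 : m = 0.
    apply: (mulIf z0); rewrite mul0r.
    by move: E00; rewrite !(mul0r, mulr0, add0r).
  by rewrite P00 P01 P10 P11 mu0 m0 !(mulr0, addr0).
subst z; rewrite !(mul0r, mulr0, add0r, addr0) in E00 E10 E11 P10 P11.
have xl : x * lam = 0 by apply: (fixed_mul_eq0 p1); rewrite -E00 mulrC.
have tm : t * mu = 0 by apply: (fixed_mul_eq0 p1); rewrite -E11 mulrC.
have {BA0} xy0 : x * m + y * mu != 0.
  by apply/eqP => H; case: BA0; rewrite P00 P01 P10 P11 xl tm H.
have [lam0|lam0] := eqVneq lam 0.
  subst lam; have [mu0|mu0] := eqVneq mu 0; last first.
    (* Here the corner of [A B] vanishes although that of [B A] does not, which is absurd. *)
    have t0 : t = 0 by apply: (mulIf mu0); rewrite tm mul0r.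
    move/esym/eqP: E01; rewrite t0 mulr0 mul0r addr0 mulf_eq0 (negPf p0).
    by rewrite (negPf xy0).
  subst mu; rewrite mulr0 addr0 in xy0 E01.
  have [x0 m0] : x != 0 /\ m != 0.
    by move: xy0; rewrite mulf_eq0 negb_or => /andP.
  rewrite mul0r add0r in E01.
  have tE : t = p * x by apply: (mulfI m0); rewrite E01; ring.
  have tx : t - x != 0.
    by rewrite tE -{2}[x]mul1r -mulrBl mulf_neq0 // subr_eq0.
  (* Solving [B u = t *: u] for [u = c *: v + w] gives this coefficient; [A] sends [u] to
     [m *: v]. *)
  exists ((y / (t - x)) *: v + 1 *: w), t.
  split; first by rewrite tE mulf_neq0.
  right; rewrite !linearD !linearZ /= Av Aw Bv Bw.
  rewrite !scale0r scaler0 add0r addr0 !scale1r.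
  split; last by have := comb0 m 0; rewrite scale0r addr0 m0; apply.
  rewrite addrA !scalerA -scalerDl; congr (_ *: _ + _).
  by field.
have x0 : x = 0 by apply: (mulIf lam0); rewrite xl mul0r.
subst x; rewrite mul0r add0r in xy0.
have [y0 mu0] : y != 0 /\ mu != 0.
  by move: xy0; rewrite mulf_eq0 negb_or => /andP.
have t0 : t = 0 by apply: (mulIf mu0); rewrite tm mul0r.
subst t; rewrite mulr0 addr0 mul0r add0r in E01.
have lamE : lam = p * mu by apply: (mulIf y0); rewrite E01; ring.
have ml : mu - lam != 0.
  by rewrite lamE -{1}[mu]mul1r -mulrBl mulf_neq0 // subr_eq0 eq_sym.
(* The same computation for [A] and [mu]; [B] sends this vector to [y *: v]. *)
exists ((m / (mu - lam)) *: v + 1 *: w), mu; split=> //; left.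
rewrite !linearD !linearZ /= Av Aw Bv Bw !scale0r !addr0 scaler0 add0r !scale1r.
split; last by have := comb0 y 0; rewrite scale0r addr0 y0; apply.
rewrite addrA !scalerA -scalerDl; congr (_ *: _ + _).
by field.
Qed.

End PlaneOperators.

(** * From an eigenvector of one member to the shape of the whole tuple *)

Section Classification.
Variables (R : realType) (n : nat) (q : 'I_n.+1 -> 'I_n.+1 -> R[i]).
Variable T : 'I_n.+1 -> 'End('cV[R[i]]_2).
Hypotheses (hq : q_commuting q T) (hnz : forall i, T i != 0).

(** [q_commuting] constrains only pairs with [i < j]; the reversed pair follows by inverting a
    unimodular scalar. *)
Lemma q_commuting_neq i j : i != j ->
  `|q i j| = 1 /\ (T i \o T j)%VF = q i j *: (T j \o T i)%VF.
Proof.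
rewrite neq_ltn => /orP[ij|ji]; first by have [? _ ?] := hq ij.
have [q1 qV TT] := hq ji.
have q0 : q j i != 0 by rewrite -normr_eq0 q1 oner_eq0.
have {}qV : q i j = (q j i)^-1 by rewrite qV invrK.
split; first by rewrite qV normrV ?unitfE // q1 invr1.
by rewrite TT scalerA qV mulVf // scale1r.
Qed.

Lemma q_neq0 i j : i != j -> q i j != 0.
Proof. by move=> /q_commuting_neq[q1 _]; rewrite -normr_eq0 q1 oner_eq0. Qed.

(** [T j] carries [v] to an eigenvector of [T i] for [q i j * lam], which differs from [lam]. By the
    choice of basis the first column of [T j] is that of [E21]. *)
Lemma q_basis i j v lam : i != j -> q i j != 1 -> lam != 0 ->
  T i v = lam *: v -> T j v != 0 ->
  let b := [tuple v; T j v] in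
  [/\ basis_of fullv b,
      mx_in_basis b (T i) = mx2 lam 0 0 (q i j * lam),
      mx_in_basis b (T j) 0 0 = 0 & mx_in_basis b (T j) 1 0 = 1].
Proof.
move=> ij q1 lam0 Tv Tjv b.
have Tw : T i (T j v) = (q i j * lam) *: T j v.
  have [_ /lfunP/(_ v)] := q_commuting_neq ij.
  by rewrite scale_lfunE !comp_lfunE Tv linearZ scalerA.
have v0 : v != 0 by apply: contraNneq Tjv => ->; rewrite linear0.
have ll : lam != q i j * lam.
  by rewrite -{1}[lam]mul1r -subr_eq0 -mulrBl mulf_neq0 // subr_eq0 eq_sym.
have bP : basis_of fullv b := eigen_basis v0 Tjv Tv Tw ll.
have bv : tnth b 0 = v by []. have bw : tnth b 1 = T j v by [].
have [] := @mx_in_basis_eq _ (T i) b 0 lam 0 bP.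
  by rewrite bv scale0r addr0.
have [] := @mx_in_basis_eq _ (T i) b 1 0 (q i j * lam) bP.
  by rewrite bw scale0r add0r.
have [] := @mx_in_basis_eq _ (T j) b 0 0 1 bP.
  by rewrite bv bw scale0r add0r scale1r.
move=> N0 N1 M01 M11 M00 M10; split=> //.
by rewrite [LHS]mx2E M01 M11 M00 M10.
Qed.

Lemma tperm_ord0_neq (i m : 'I_n.+1) : m != ord0 -> i != tperm ord0 i m.
Proof. by rewrite -{1}(tpermL ord0 i) (inj_eq perm_inj) eq_sym. Qed.

Lemma eta_set_tperm i m (alpha : R[i]) :
  m \in eta_set (fun j => T (tperm ord0 i j)) alpha ->
  (T i \o T (tperm ord0 i m))%VF = alpha *: (T (tperm ord0 i m) \o T i)%VF.
Proof. by rewrite finset.in_set tpermL => /eqP. Qed.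

Lemma mx_in_basis_nz i (b : 2.-tuple 'cV[R[i]]_2) :
  basis_of fullv b -> mx_in_basis b (T i) != 0.
Proof. by move=> bP; apply: contraNneq (hnz i) => /(mx_in_basis_eq0 bP)/eqP. Qed.

(** Compare the lower left entries of the relation between [T m] and [T j]. Unimodularity of [q m j]
    then gives the equal moduli of Type I, and the value of the ratio later decides whether [T m]
    can replace the first operator. *)
Lemma lower_entry_ratio m j (b : 2.-tuple 'cV[R[i]]_2) : m != j ->
  basis_of fullv b ->
  mx_in_basis b (T j) 0 0 = 0 -> mx_in_basis b (T j) 1 0 = 1 ->
  mx_in_basis b (T m) 1 0 = 0 ->
  mx_in_basis b (T m) 1 1 = q m j * mx_in_basis b (T m) 0 0.
Proof.
move=> mj bP Mj00 Mj10 Mm10.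
have := mx_in_basis_qcomm 1 0 bP (q_commuting_neq mj).2.
by rewrite /= Mj00 Mj10 Mm10 !(mulr0, add0r, addr0, mulr1, mul1r).
Qed.

(** Since [r] is neither 1 nor -1, its square is not 1, and this kills the second column of [T j],
    leaving exactly [E21]. Commuting with [E21] up to a scalar then removes the upper right entry of
    every other member. *)
Lemma type_I_of_eigenvector i j v lam : i != j -> q i j != 1 -> q i j != -1 ->
  lam != 0 -> T i v = lam *: v -> T j v != 0 ->
  exists (s : 'S_n.+1) (b : 2.-tuple 'cV[R[i]]_2), basis_of fullv b /\
    type_I (fun i j => q (s i) (s j)) (fun i => T (s i)) b.
Proof.
move=> ij; have [r_norm TTij] := q_commuting_neq ij; have r0 := q_neq0 ij.
set r := q i j in r_norm TTij r0 * => r1 rN1 lam0 Tv Tjv.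
have [] := q_basis ij r1 lam0 Tv Tjv; rewrite -/r.
set b := [tuple v; T j v] => bP Mi Mj00 Mj10.
have [_ Mj01 _ Mj11] := diag_qcomm bP lam0 r0 Mi TTij.
have rr1 : r * r != 1 by rewrite -expr2 sqrf_eq1 negb_or r1.
have {}Mj01 := fixed_mul_eq0 rr1 Mj01.
have {}Mj11 := fixed_mul_eq0 r1 Mj11.
exists (tperm ord0 i), b; split=> //; exists lam, r; rewrite tpermL.
split=> // k0 k00.
have im := tperm_ord0_neq i k00.
have eta := @eta_set_tperm i k0.
(* After swapping [i] with the first index, the remaining members are the [T m] with [m != i]. *)
move: (tperm ord0 i k0) im eta => m im eta.
have [] := diag_qcomm bP lam0 r0 Mi (q_commuting_neq im).2.
have := mx_in_basis_nz m bP; set M := mx_in_basis b (T m).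
move: (mx2E M); set x := M 0 0; set y := M 0 1; set z := M 1 0; set w := M 1 1.
move=> -> M0 xE yE zE wE.
have y_eq0 : m != j -> y = 0.
  move=> mj; have := mx_in_basis_qcomm 0 0 bP (q_commuting_neq mj).2.
  rewrite /= -/M Mj00 Mj10 Mj01 -/x -/y.
  by rewrite !(mul0r, mulr0, add0r, mulr1).
split.
- have [p1|p1] := eqVneq (q i m) 1; [by left|right].
  have [mj|mj] := eqVneq m j; first by rewrite mj.
  have x0 := fixed_mul_eq0 p1 xE; have w0 := fixed_mul_eq0 p1 wE.
  (* Only the lower left entry is left, and comparing its coefficients gives [q i m = r]. *)
  have z0 : z != 0.
    by apply: contraNneq M0 => z0; rewrite x0 w0 z0 y_eq0 // mx2_0.
  by apply: (mulIf z0); rewrite zE.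
- move=> /eta eta1.
  have [] := commute_diag bP lam0 r0 r1 Mi eta1; rewrite -/M -/y -/z => y0 z0.
  have mj : m != j.
    apply: contra_neq (oner_neq0 R[i]) => mj.
    by rewrite -[LHS]Mj10 -mj -/M -/z z0.
  have wx : `|x| = `|w|.
    rewrite [w](lower_entry_ratio mj bP) // normrM (q_commuting_neq mj).1.
    by rewrite mul1r.
  exists x, w; split=> //; last by rewrite y0 z0.
  apply: contraNneq M0 => w0; rewrite w0 in wx.
  by rewrite y0 z0 (normr0_eq0 wx) (normr0_eq0 w0) mx2_0.
- move=> /eta etar; have [x0 y0 _ w0] := diag_qcomm bP lam0 r0 Mi etar.
  rewrite -/M -/x -/y -/w in x0 y0 w0.
  have {}x0 := fixed_mul_eq0 r1 x0; have {}w0 := fixed_mul_eq0 r1 w0.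
  have {}y0 := fixed_mul_eq0 rr1 y0.
  exists z; rewrite x0 y0 w0; split=> //.
  by apply: contraNneq M0 => z0; rewrite x0 y0 z0 w0 mx2_0.
Qed.

(** Either operator of the pair may be the one that supplies the eigenvector, hence the fresh
    indices [i'] and [j']. *)
Lemma noncommuting_eigenvector i j : (T i \o T j)%VF != (T j \o T i)%VF ->
  exists i' j' v lam, [/\ i' != j', q i' j' != 1, lam != 0,
    T i' v = lam *: v & T j' v != 0].
Proof.
move=> nij; have ij : i != j by apply: contraNneq nij => ->.
have [_ TT] := q_commuting_neq ij.
have q1 : q i j != 1 by apply: contraNneq nij => qE; rewrite TT qE scale1r.
have q1' : q j i != 1.
  have ji : j != i by rewrite eq_sym.
  have [_ TT'] := q_commuting_neq ji.
  by apply: contraNneq nij => qE; rewrite TT' qE scale1r.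
have ji0 : (T j \o T i)%VF != 0.
  by apply: contraNneq nij => H; rewrite TT H scaler0.
have [v [lam [lam0 [[Tv Tv']|[Tv Tv']]]]] :=
  qcomm_eigenvector (q_neq0 ij) q1 TT ji0.
- by exists i, j, v, lam.
- by exists j, i, v, lam; rewrite eq_sym.
Qed.

(** With ratio -1 both off-diagonal entries may survive, so [T j] need not be [E21]. The condition
    on the diagonal members says that none of them yields a ratio other than 1 and -1. *)
Lemma type_III_of_eigenvector i j v lam : i != j -> q i j = -1 -> lam != 0 ->
  T i v = lam *: v -> T j v != 0 ->
  let b := [tuple v; T j v] in
  (forall m, m != i -> (T i \o T m)%VF = 1 *: (T m \o T i)%VF ->
    let M := mx_in_basis b (T m) in M 1 1 = M 0 0 \/ M 1 1 = - M 0 0) ->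
  exists s : 'S_n.+1, basis_of fullv b /\
    type_III (fun i j => q (s i) (s j)) (fun i => T (s i)) b.
Proof.
move=> ij r_eq lam0 Tv Tjv b diag_pm.
have N1 : -1 != 1 :> R[i] by rewrite eq_sym -subr_eq0 opprK -mulr2n pnatr_eq0.
have q1 : q i j != 1 by rewrite r_eq.
have N0 : -1 != 0 :> R[i] by rewrite oppr_eq0 oner_eq0.
have [] := q_basis ij q1 lam0 Tv Tjv; rewrite -/b r_eq => bP Mi Mj00 Mj10.
exists (tperm ord0 i); split=> //; exists lam; rewrite tpermL.
split=> // [|k0 k00]; first by rewrite Mi mulN1r.
have im := tperm_ord0_neq i k00.
have eta := @eta_set_tperm i k0.
move: (tperm ord0 i k0) im eta => m im eta.
have [] := diag_qcomm bP lam0 N0 Mi (q_commuting_neq im).2.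
have := mx_in_basis_nz m bP.
have := diag_pm m; rewrite eq_sym im => /(_ isT) /=.
set M := mx_in_basis b (T m).
move: (mx2E M); set x := M 0 0; set y := M 0 1; set z := M 1 0; set w := M 1 1.
move=> -> {}diag_pm M0 xE yE zE wE.
split.
(* If the scalar is not 1, the diagonal vanishes, and whichever off-diagonal entry is nonzero forces
   the scalar to be -1. *)
- have [p1|p1] := eqVneq (q i m) 1; [by left|right].
  have x0 := fixed_mul_eq0 p1 xE; have w0 := fixed_mul_eq0 p1 wE.
  have [z0|z0] := eqVneq z 0; last by apply: (mulIf z0); rewrite zE.
  have y0 : y != 0 by apply: contraNneq M0 => y0; rewrite x0 w0 z0 y0 mx2_0.
  apply: (mulIf y0); rewrite [in RHS]yE; ring.
- move=> /eta eta1; have {}diag_pm := diag_pm eta1.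
  have [] := commute_diag bP lam0 N0 N1 Mi eta1; rewrite -/M -/y -/z => y0 z0.
  exists x; split; last by case: diag_pm => ->; rewrite y0 z0; [left|right].
  apply: contraNneq M0 => x0.
  by case: diag_pm => ->; rewrite x0 y0 z0 ?oppr0 mx2_0.
- move=> /eta etaN; have [x0 _ _ w0] := diag_qcomm bP lam0 N0 Mi etaN.
  rewrite -/M -/x -/w in x0 w0.
  have {}x0 := fixed_mul_eq0 N1 x0; have {}w0 := fixed_mul_eq0 N1 w0.
  exists y, z; rewrite x0 w0; split=> //.
  apply/orP; rewrite -negb_and; apply: contra M0 => /andP[/eqP y0 /eqP z0].
  by rewrite x0 y0 z0 w0 mx2_0.
Qed.

Lemma noncommuting_classification i0 j0 :
  (T i0 \o T j0)%VF != (T j0 \o T i0)%VF ->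
  exists (s : 'S_n.+1) (b : 2.-tuple 'cV[R[i]]_2),
    let Ts := fun i => T (s i) in let qs := fun i j => q (s i) (s j) in
    basis_of fullv b /\ (type_I qs Ts b \/ type_III qs Ts b).
Proof.
move=> nij.
have [i [j [v [lam [ij q1 lam0 Tv Tjv]]]]] := noncommuting_eigenvector nij.
(* The vector [v] and the index [j] stay fixed while the first operator may change. *)
have type_I_case i' lam' : i' != j -> q i' j != 1 -> q i' j != -1 ->
    lam' != 0 -> T i' v = lam' *: v ->
  exists (s : 'S_n.+1) (b : 2.-tuple 'cV[R[i]]_2),
    let Ts := fun i => T (s i) in let qs := fun i j => q (s i) (s j) in
    basis_of fullv b /\ (type_I qs Ts b \/ type_III qs Ts b).
  move=> i'j q1' qN1' lam'0 Tv'.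
  have [s [b [bP bI]]] := type_I_of_eigenvector i'j q1' qN1' lam'0 Tv' Tjv.
  by exists s, b; split=> //; left.
have [qN1|qN1] := eqVneq (q i j) (-1); last exact: (type_I_case i lam).
have [bP Mi Mj00 Mj10] := q_basis ij q1 lam0 Tv Tjv.
set b := [tuple v; T j v] in bP Mi Mj00 Mj10.
(* A bad [m] is a diagonal member that Type III cannot accommodate. It has [v] as an eigenvector and
   diagonal ratio [q m j], so this scalar is neither 1 nor -1 and [T m] can be the first operator of
   Type I. *)
pose bad m := [&& (T i \o T m)%VF == 1 *: (T m \o T i)%VF,
  mx_in_basis b (T m) 1 1 != mx_in_basis b (T m) 0 0 &
  mx_in_basis b (T m) 1 1 != - mx_in_basis b (T m) 0 0].
have [/existsP[m /and3P[/eqP eta1 w1 wN1]]|good] := boolP [exists m, bad m].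
  have [_ z0] := commute_diag bP lam0 (q_neq0 ij) q1 Mi eta1.
  have mj : m != j.
    by apply: contra_neq (oner_neq0 R[i]) => mj; rewrite -[LHS]Mj10 -mj z0.
  have wE := lower_entry_ratio mj bP Mj00 Mj10 z0.
  apply: (type_I_case m (mx_in_basis b (T m) 0 0)) => //.
  - by apply: contraNneq w1 => p1; rewrite wE p1 mul1r.
  - by apply: contraNneq wN1 => p1; rewrite wE p1 mulN1r.
  (* A zero eigenvalue would make both diagonal entries zero, hence equal. *)
  - by apply: contraNneq w1 => x0; rewrite wE x0 mulr0.
  - by have := mx_in_basisP (T m) 0 bP; rewrite z0 scale0r addr0.
have [s [_ bIII]] : exists s : 'S_n.+1, basis_of fullv b /\
    type_III (fun i j => q (s i) (s j)) (fun i => T (s i)) b.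
  apply: (type_III_of_eigenvector ij qN1 lam0 Tv Tjv) => m mi eta1 M.
  have [w1|w1] := eqVneq (M 1 1) (M 0 0); [by left|right].
  apply/eqP; apply: contraNT good => wN1.
  by apply/existsP; exists m; rewrite /bad eta1 eqxx w1.
by exists s, b; split=> //; right.
Qed.

End Classification.

Theorem theorem3p4 (R : realType) (n : nat)
    (q : 'I_n.+1 -> 'I_n.+1 -> R[i])
    (T : 'I_n.+1 -> 'End('cV[R[i]]_2))
    (hq : q_commuting q T)
    (hcontr : forall i : 'I_n.+1, contraction (T i))
    (hnz : forall i : 'I_n.+1, T i != 0) :
  commuting T \/
  exists s : 'S_n.+1, exists b : 2.-tuple 'cV[R[i]]_2,
    let Ts := fun i : 'I_n.+1 => T (s i) in
    let qs := fun i j : 'I_n.+1 => q (s i) (s j) in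
    basis_of fullv b /\
    [\/ type_I qs Ts b, type_II qs Ts b | type_III qs Ts b].
Proof.
have [/existsP[i /existsP[j nij]]|comm] :=
  boolP [exists i, exists j, (T i \o T j)%VF != (T j \o T i)%VF].
  right; have [s [b [bP bT]]] := noncommuting_classification hq hnz nij.
  by exists s, b; split=> //; case: bT => bT; [apply: Or31|apply: Or33].
left=> i j; apply/eqP; apply: contraNT comm => nij.
by apply/existsP; exists i; apply/existsP; exists j.
Qed.
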